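(* Let $k,m,n\ge1$, $1\le l\le m$, let $\mu$ be a measure on $[k]$, and for $1\le i\le n$ let $a^i_1,\dots,a^i_m\subseteq[k]$. Then $$e_l\Big(\bigcup_{i=1}^n\{a^i_1,\dots,a^i_m\}\Big)=\frac{1}{(m!)^{n-1}}\sum_{\substack{\sigma\in\{\mathrm{id}\}\times S_m^{n-1}\\ 1\le t_1<t_2<\cdots<t_l\le m\\ f:[l]\to P([n])\setminus\{\emptyset\}}}\ \prod_{j=1}^{l}(-1)^{|f(j)|+1}\,\mu\Big(\bigcap_{i\in f(j)}a^i_{\sigma_i(t_j)}\Big),$$ where $\sigma=(\sigma_1,\dots,\sigma_n)$ with $\sigma_1=\mathrm{id}$.
   Context: Work over $\mathbb{R}$. $[k]=\{1,\dots,k\}$; $\langle P[k]\rangle$ is the real vector space with basis the subsets of $[k]$, with union the bilinear extension of set union; $\langle P[k]\rangle^{\otimes m}$ has componentwise union and $S_m$ permutes tensor factors. $\mathrm{Sym}^m\langle P[k]\rangle=\langle P[k]\rangle^{\otimes m}/S_m$ (coinvariants), $\{a_1,\dots,a_m\}$ denotes the class of $a_1\otimes\cdots\otimes a_m$, union on it is $\bar u\cup\bar v=\frac{1}{m!}\sum_{\tau\in S_m}\overline{u\cup\tau v}$, and $\bigcup_{i=1}^n$ is the iterated union. A measure on $[k]$ is a map $\mu:P([k])\to\mathbb{R}$ with $\mu(a\cup b)=\mu(a)+\mu(b)$ for disjoint $a,b$. The elementary symmetric function is $e_l(x_1,\dots,x_m)=\sum_{1\le t_1<\cdots<t_l\le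 m}\prod_{j=1}^l x_{t_j}$, and $e_l:\mathrm{Sym}^m\langle P[k]\rangle\to\mathbb{R}$ is the linear map with $e_l(\{a_1,\dots,a_m\})=e_l(\mu(a_1),\dots,\mu(a_m))$. *)

(* Defs.v *)
From HB Require Import structures.
From mathcomp Require Import all_boot all_order all_fingroup all_algebra.
From mathcomp Require Import generic_quotient ring_quotient reals.

Set Implicit Arguments.
Unset Strict Implicit.
Unset Printing Implicit Defensive.

Import Order.TTheory GRing.Theory Num.Theory.
Local Open Scope ring_scope.
Local Open Scope quotient_scope.

(* [free_on T] is the real vector space with basis [basis t], t : T.          *)
Section FreeSpace.
Variables (R : realType) (T : finType).

Definition free_on := {ffun T -> R^o}.

Definition basis (t : T) : free_on := [ffun s => (s == t)%:R].

Lemma free_on_sum (u : free_on) : u = \sum_t u t *: basis t.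
Proof.
apply/ffunP => s; rewrite sum_ffunE (bigD1 s) //= !ffunE eqxx.
rewrite big1 ?addr0 => [|t ts]; first by rewrite [_ *: _]mulr1.
by rewrite !ffunE eq_sym (negbTE ts) [_ *: _]mulr0.
Qed.

Definition bilinear_ext (op : T -> T -> T) (u v : free_on) : free_on :=
  \sum_s \sum_t (u s * v t) *: basis (op s t).

Lemma bilinear_extDl op c u u' v :
  bilinear_ext op (c *: u + u') v
  = c *: bilinear_ext op u v + bilinear_ext op u' v.
Proof.
rewrite /bilinear_ext scaler_sumr -big_split; apply: eq_bigr => s _ /=.
rewrite scaler_sumr -big_split; apply: eq_bigr => t _ /=.
by rewrite !ffunE mulrDl scalerDl scalerA mulrA.
Qed.

Lemma bilinear_extDr op c u v v' :
  bilinear_ext op u (c *: v + v')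
  = c *: bilinear_ext op u v + bilinear_ext op u v'.
Proof.
rewrite /bilinear_ext scaler_sumr -big_split; apply: eq_bigr => s _ /=.
rewrite scaler_sumr -big_split; apply: eq_bigr => t _ /=.
rewrite !ffunE mulrDr scalerDl scalerA; congr (_ *: _ + _).
exact: (@mulrCA R).
Qed.

Lemma bilinear_extBl op u u' v :
  bilinear_ext op (u - u') v = bilinear_ext op u v - bilinear_ext op u' v.
Proof.
by rewrite -[u - u']addrC -scaleN1r bilinear_extDl scaleN1r addrC.
Qed.

Lemma bilinear_extBr op u v v' :
  bilinear_ext op u (v - v') = bilinear_ext op u v - bilinear_ext op u v'.
Proof.
by rewrite -[v - v']addrC -scaleN1r bilinear_extDr scaleN1r addrC.
Qed.

Lemma bilinear_ext_basis op s t :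
  bilinear_ext op (basis s) (basis t) = basis (op s t).
Proof.
rewrite /bilinear_ext (bigD1 s) //= (bigD1 t) //= !ffunE !eqxx mulr1 scale1r.
rewrite [X in _ + X + _]big1 => [|t' tt']; last first.
  by rewrite !ffunE (negbTE tt') mulr0 scale0r.
rewrite addr0 big1 ?addr0 // => s' ss'; rewrite big1 // => t' _.
by rewrite !ffunE (negbTE ss') mul0r scale0r.
Qed.

Lemma free_on_ext (V : lmodType R) (f g : free_on -> V) :
  linear f -> linear g -> (forall t, f (basis t) = g (basis t)) -> f =1 g.
Proof.
move=> fL gL fg u.
pose F : {linear free_on -> V} :=
  HB.pack f (GRing.isLinear.Build R free_on V *:%R f fL).
pose G : {linear free_on -> V} :=
  HB.pack g (GRing.isLinear.Build R free_on V *:%R g gL).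
rewrite (free_on_sum u) -[f]/(F : _ -> _) -[g]/(G : _ -> _) !linear_sum.
by apply: eq_bigr => t _; rewrite !linearZ /= fg.
Qed.

Lemma bilinear_extA op : associative op -> associative (bilinear_ext op).
Proof.
move=> opA u v w; move: u; apply: free_on_ext => [c u u'|c u u'|s].
- by rewrite !bilinear_extDl.
- by rewrite !bilinear_extDl.
move: v; apply: free_on_ext => [c v v'|c v v'|t].
- by rewrite bilinear_extDl bilinear_extDr.
- by rewrite bilinear_extDr bilinear_extDl.
move: w; apply: free_on_ext => [c w w'|c w w'|r].
- by rewrite !bilinear_extDr.
- by rewrite !bilinear_extDr.
by rewrite !bilinear_ext_basis opA.
Qed.

Lemma bilinear_extC op : commutative op -> commutative (bilinear_ext op).
Proof.
move=> opC u v; rewrite /bilinear_ext exchange_big; apply: eq_bigr => s _.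
by apply: eq_bigr => t _; rewrite mulrC opC.
Qed.

Lemma bilinear_ext_id op e :
  left_id e op -> left_id (basis e) (bilinear_ext op).
Proof.
move=> ope; apply: free_on_ext => [c u v|//|t].
- by rewrite bilinear_extDr.
- by rewrite bilinear_ext_basis ope.
Qed.

End FreeSpace.

Section TensorPower.
Variables (R : realType) (k m : nat).

Definition pspace := free_on R {set 'I_k}.

Definition punion : pspace -> pspace -> pspace :=
  bilinear_ext (fun a b => a :|: b).

(* The m-th tensor power of [pspace], in its basis of the pure tensors        *)
(* a_1 (x) ... (x) a_m of subsets; [pure] is the universal multilinear map.   *)
Definition words := {ffun 'I_m -> {set 'I_k}}.
Definition tensor := free_on R words.

Definition pure (v : 'I_m -> pspace) : tensor :=
  [ffun a : words => \prod_i v i (a i)].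

Definition wunion (a b : words) : words := [ffun i => a i :|: b i].

Definition tunion : tensor -> tensor -> tensor := bilinear_ext wunion.

Lemma pure_basis (a : words) : pure (fun i => basis R (a i)) = basis R a.
Proof.
apply/ffunP => b; rewrite !ffunE; case: eqP => [->|ab].
  by rewrite big1 // => i _; rewrite ffunE eqxx.
case: (pickP (fun i => b i != a i)) => [i bai|E].
  by rewrite (bigD1 i) //= ffunE (negbTE bai) mul0r.
by case: ab; apply/ffunP => i; apply/eqP/negbFE/E.
Qed.

(* Left action: tau (v_1 (x) ... (x) v_m) has i-th factor v_(tau^-1 i). *)
Definition tact (tau : 'S_m) (u : tensor) : tensor :=
  [ffun a : words => u [ffun i => a (tau i)]].

Lemma tact_pure tau v : tact tau (pure v) = pure (fun i => v (tau^-1%g i)).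
Proof.
apply/ffunP => a; rewrite !ffunE [RHS](reindex_inj (@perm_inj _ tau)).
by apply: eq_bigr => i _; rewrite ffunE permK.
Qed.

Lemma tact_is_linear tau : linear (tact tau).
Proof. by move=> c u v; apply/ffunP => a; rewrite !ffunE. Qed.
HB.instance Definition _ tau :=
  GRing.isLinear.Build R tensor tensor *:%R (tact tau) (tact_is_linear tau).

Lemma tactM s t u : tact s (tact t u) = tact (t * s)%g u.
Proof.
apply/ffunP => a; rewrite !ffunE; congr (u _).
by apply/ffunP => i; rewrite !ffunE permM.
Qed.

Lemma tact1 u : tact 1%g u = u.
Proof.
apply/ffunP => a; rewrite !ffunE; congr (u _).
by apply/ffunP => i; rewrite !ffunE perm1.
Qed.

Definition wact (tau : 'S_m) (a : words) : words := [ffun i => a (tau^-1%g i)].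

Lemma tact_basis tau a : tact tau (basis R a) = basis R (wact tau a).
Proof.
rewrite -!pure_basis tact_pure; apply/ffunP => b; rewrite !ffunE.
by apply: eq_bigr => i _; rewrite !ffunE.
Qed.

Lemma tunion_act tau u v :
  tact tau (tunion u v) = tunion (tact tau u) (tact tau v).
Proof.
have act_inj : injective (fun a : words => [ffun i => a (tau i)] : words).
  move=> a b /ffunP E; apply/ffunP => i.
  by have := E (tau^-1%g i); rewrite !ffunE permKV.
rewrite /tunion /bilinear_ext linear_sum.
rewrite (reindex_inj act_inj); apply: eq_bigr => a _ /=.
rewrite linear_sum (reindex_inj act_inj); apply: eq_bigr => b _ /=.
rewrite linearZ /= tact_basis !ffunE; congr (_ *: basis _ _).
by apply/ffunP => i; rewrite !ffunE !permKV.
Qed.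

Lemma tunion_pure (u v : 'I_m -> pspace) :
  tunion (pure u) (pure v) = pure (fun i => punion (u i) (v i)).
Proof.
have E (x y : pspace) c : punion x y c =
    \sum_(p : {set 'I_k} * {set 'I_k} | p.1 :|: p.2 == c) x p.1 * y p.2.
  rewrite /punion /bilinear_ext sum_ffunE [RHS]big_mkcond.
  rewrite -(pair_bigA_idem _ (fun a b =>
    if a :|: b == c then x a * y b else 0)) /= ?addr0 //.
  apply: eq_bigr => a _; rewrite sum_ffunE; apply: eq_bigr => b _.
  rewrite !ffunE eq_sym; case: eqP => _; first by rewrite [_ *: _]mulr1.
  by rewrite [_ *: _]mulr0.
apply/ffunP => c; rewrite ffunE.
under [RHS]eq_bigr do rewrite E big_mkcond.
rewrite bigA_distr_bigA /= /tunion /bilinear_ext sum_ffunE.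
rewrite (eq_bigr _ (fun a _ => sum_ffunE _ _ _ _)) pair_bigA /=.
pose h (f : {ffun 'I_m -> {set 'I_k} * {set 'I_k}}) : words * words :=
  ([ffun i => (f i).1], [ffun i => (f i).2]).
rewrite (reindex h) /=; last first.
  exists (fun p : words * words => [ffun i => (p.1 i, p.2 i)]) => [f|[a b]] _.
    by apply/ffunP => i; rewrite !ffunE; case: (f i).
  by congr (_, _); apply/ffunP => i; rewrite !ffunE.
apply: eq_bigr => f _; rewrite !ffunE.
case: eqP => [cE|cN].
  rewrite [_ *: _]mulr1 -big_split /=; apply: eq_bigr => i _.
  by rewrite cE !ffunE eqxx.
rewrite [_ *: _]mulr0; apply/esym/eqP/prodf_eq0.
case: (pickP (fun i => (f i).1 :|: (f i).2 != c i)) => [i fi|Ef].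
  by exists i => //; rewrite (negbTE fi).
by case: cN; apply/ffunP => i; rewrite !ffunE; apply/esym/eqP/negbFE/Ef.
Qed.

End TensorPower.

Section Sym.
Variables (R : realType) (k m : nat).
Local Notation tensor := (tensor R k m).

Definition tact_sub (tau : 'S_m) (u : tensor) : tensor := tact tau u - u.

Fact tact_sub_is_linear tau : linear (tact_sub tau).
Proof.
by move=> c u v; rewrite /tact_sub linearP scalerBr opprD addrACA.
Qed.
HB.instance Definition _ tau := GRing.isLinear.Build R tensor tensor *:%R
  (tact_sub tau) (tact_sub_is_linear tau).

(* The span of all the tau u - u. *)
Definition coinv_rel : {vspace tensor} :=
  (\sum_(tau : 'S_m) limg (linfun (tact_sub tau)))%VS.

Definition sym : predArgType := Quotient.quot coinv_rel.
HB.instance Definition _ := GRing.Zmodule.on sym.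
HB.instance Definition _ := EqQuotient.on sym.

Definition cls (u : tensor) : sym := \pi_sym u.

Lemma cls_repr (x : sym) : cls (repr x) = x.
Proof. exact: reprK. Qed.

Lemma eq_cls u v : (cls u == cls v) = (u - v \in coinv_rel).
Proof. by rewrite [RHS]Quotient.idealrBE. Qed.

Lemma clsD u v : cls (u + v) = cls u + cls v.
Proof. by rewrite [LHS]Quotient.pi_add. Qed.

Definition sym_scale (c : R) (x : sym) : sym := cls (c *: repr x).

Lemma sym_scaleE c u : sym_scale c (cls u) = cls (c *: u).
Proof.
apply/eqP; rewrite eq_cls -scalerBr memvZ //.
by rewrite -eq_cls cls_repr.
Qed.

Lemma sym_scaleA a b x : sym_scale a (sym_scale b x) = sym_scale (a * b) x.
Proof. by rewrite -[x]cls_repr !sym_scaleE scalerA. Qed.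
Lemma sym_scale1 : left_id 1 sym_scale.
Proof. by move=> x; rewrite -[x]cls_repr sym_scaleE scale1r. Qed.
Lemma sym_scaleDr : right_distributive sym_scale +%R.
Proof.
move=> c x y; rewrite -[x]cls_repr -[y]cls_repr -clsD !sym_scaleE.
by rewrite scalerDr clsD.
Qed.
Lemma sym_scaleDl x : {morph sym_scale^~ x : a b / a + b}.
Proof. by move=> a b; rewrite -[x]cls_repr !sym_scaleE scalerDl clsD. Qed.

HB.instance Definition _ := GRing.Zmodule_isLmodule.Build R sym
  sym_scaleA sym_scale1 sym_scaleDr sym_scaleDl.

Lemma cls_is_linear : linear cls.
Proof. by move=> c u v; rewrite clsD -sym_scaleE. Qed.
HB.instance Definition _ :=
  GRing.isLinear.Build R tensor sym *:%R cls cls_is_linear.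

Lemma cls_act tau u : cls (tact tau u) = cls u.
Proof.
apply/eqP; rewrite eq_cls.
apply: (subvP (sumv_sup tau _ (subvv _))) => //.
have := memv_img (linfun (tact_sub tau)) (memvf u).
by rewrite lfunE.
Qed.

Lemma cls_lift (V : zmodType) (f : tensor -> V) :
    {morph f : u v / u - v} -> (forall tau u, f (tact tau u) = f u) ->
  forall u v, cls u = cls v -> f u = f v.
Proof.
move=> fB fact u v /eqP; rewrite eq_cls => uv.
have f0 : f 0 = 0 by rewrite -[X in f X](subrr 0) fB subrr.
have fN y : f (- y) = - f y by rewrite -[- y]sub0r fB f0 sub0r.
have fD x y : f (x + y) = f x + f y by rewrite -[y in LHS]opprK fB fN opprK.
apply/eqP; rewrite -subr_eq0 -fB; case/memv_sumP: uv => w wI ->.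
apply/eqP; elim/big_rec: _ => // tau x _ fx0; rewrite fD fx0 addr0.
have /memv_imgP[y _ ->] := wI tau isT.
by rewrite lfunE /= /tact_sub fB fact subrr.
Qed.

(* {a_1, ..., a_m} *)
Definition sym_class (a : 'I_m -> {set 'I_k}) : sym :=
  cls (pure (fun i => basis R (a i))).

(* Independent of the representatives chosen here, by [sym_unionE] below. *)
Definition sym_union (x y : sym) : sym :=
  (m`!%:R)^-1 *: \sum_(tau : 'S_m) cls (tunion (repr x) (tact tau (repr y))).

Lemma sym_unionE u v :
  sym_union (cls u) (cls v)
  = (m`!%:R)^-1 *: \sum_(tau : 'S_m) cls (tunion u (tact tau v)).
Proof.
congr (_ *: _).
pose f u v := \sum_(tau : 'S_m) cls (tunion u (tact tau v)).
rewrite -/(f u v) -/(f (repr (cls u)) (repr (cls v))).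
transitivity (f u (repr (cls v))).
  apply: (@cls_lift _ (f^~ (repr (cls v)))); last by rewrite cls_repr.
    move=> x y; rewrite /f -sumrB; apply: eq_bigr => tau _.
    by rewrite [tunion _ _]bilinear_extBl linearB.
  move=> tau x; rewrite /f (reindex_inj (mulIg tau)); apply: eq_bigr => s _ /=.
  by rewrite -tactM -tunion_act cls_act.
apply: (@cls_lift _ (f u)); last by rewrite cls_repr.
  move=> x y; rewrite /f -sumrB; apply: eq_bigr => tau _.
  by rewrite linearB [tunion _ _]bilinear_extBr linearB.
move=> tau x; rewrite /f [RHS](reindex_inj (mulgI tau)).
by apply: eq_bigr => s _ /=; rewrite tactM.
Qed.

Definition sym_unit : sym := sym_class (fun=> set0).

Lemma tunionA : associative (@tunion R k m).
Proof.
by apply: bilinear_extA => a b c; apply/ffunP => i; rewrite !ffunE setUA.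
Qed.

Lemma tunionC : commutative (@tunion R k m).
Proof.
by apply: bilinear_extC => a b; apply/ffunP => i; rewrite !ffunE setUC.
Qed.

Lemma tunion0 : left_id (basis R ([ffun=> set0] : words k m)) (@tunion R k m).
Proof.
by apply: bilinear_ext_id => a; apply/ffunP => i; rewrite !ffunE set0U.
Qed.

Lemma fact_unit : (m`!%:R : R) != 0.
Proof. by rewrite pnatr_eq0 -lt0n fact_gt0. Qed.

Lemma sym_unionC : commutative sym_union.
Proof.
move=> x y; rewrite -[x]cls_repr -[y]cls_repr !sym_unionE; congr (_ *: _).
rewrite (reindex_inj invg_inj); apply: eq_bigr => tau _ /=.
by rewrite -(cls_act tau) tunion_act tactM mulVg tact1 tunionC.
Qed.

Lemma sym_union_unit : left_id sym_unit sym_union.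
Proof.
move=> x; rewrite -[x]cls_repr.
have -> : sym_unit = cls (basis R ([ffun=> set0] : words k m)).
  rewrite -pure_basis; congr cls; apply/ffunP => a; rewrite !ffunE.
  by apply: eq_bigr => i _; rewrite !ffunE.
rewrite sym_unionE; under eq_bigr do rewrite tunion0 cls_act.
by rewrite sumr_const card_Sn -scaler_nat scalerA mulVf ?fact_unit ?scale1r.
Qed.

Lemma sym_union_is_linear x : linear (sym_union x).
Proof.
move=> c y z; rewrite -[x]cls_repr -[y]cls_repr -[z]cls_repr -linearP.
rewrite !sym_unionE scalerA mulrC -scalerA -scalerDr; congr (_ *: _).
rewrite scaler_sumr -big_split; apply: eq_bigr => tau _ /=.
by rewrite linearP [tunion _ _]bilinear_extDr linearP.
Qed.
HB.instance Definition _ x := GRing.isLinear.Build R sym sym *:%R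
  (sym_union x) (sym_union_is_linear x).

Lemma sym_unionA : associative sym_union.
Proof.
move=> x y z; rewrite [RHS]sym_unionC -[x]cls_repr -[y]cls_repr -[z]cls_repr.
move: (repr x) (repr y) (repr z) => u v w.
rewrite (sym_unionE u v) (sym_unionE v w) !linearZ !linear_sum; congr (_ *: _).
rewrite (eq_bigr _ (fun t _ => sym_unionE _ _)).
rewrite [RHS](eq_bigr _ (fun t _ => sym_unionE _ _)).
rewrite -!scaler_sumr; congr (_ *: _).
transitivity (\sum_(s : 'S_m) \sum_(t : 'S_m)
    cls (tunion u (tunion (tact s v) (tact t w)))).
  rewrite exchange_big; apply: eq_bigr => s _ /=.
  rewrite [RHS](reindex_inj (mulIg s)); apply: eq_bigr => t _ /=.
  by rewrite tunion_act tactM.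
apply: eq_bigr => s _; rewrite [RHS](reindex_inj invg_inj).
apply: eq_bigr => t _ /=; rewrite -[in RHS](cls_act t) tunion_act tactM mulVg.
by rewrite tact1 [in RHS]tunionC tunionA.
Qed.

HB.instance Definition _ := Monoid.isComLaw.Build sym sym_unit sym_union
  sym_unionA sym_unionC sym_union_unit.

End Sym.

Arguments sym_unit {R k m}.

Definition incr (l m : nat) (t : {ffun 'I_l -> 'I_m}) : bool :=
  [forall i : 'I_l, forall j : 'I_l, (i < j)%N ==> (t i < t j)%N].

Definition elem_sym (R : realType) (l m : nat) (x : 'I_m -> R) : R :=
  \sum_(t : {ffun 'I_l -> 'I_m} | incr t) \prod_j x (t j).

Section ElementarySymmetric.
Variables (R : realType).

Lemma incr_sorted l m (t : {ffun 'I_l -> 'I_m}) :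
  incr t = sorted ltn [seq val i | i <- codom t].
Proof.
have nthE (i : 'I_l) : nth 0%N [seq val i | i <- codom t] i = t i.
  by rewrite /codom /image_mem -map_comp (nth_map i) ?size_enum_ord //= nth_ord_enum.
have sizeE : size [seq val i | i <- codom t] = l.
  by rewrite size_map size_codom card_ord.
rewrite (sorted_pairwise ltn_trans); apply/idP/(pairwiseP 0%N) => [|srt].
  move=> /forallP tI i j; rewrite !inE sizeE => il jl ij.
  have := nthE (Ordinal il); have := nthE (Ordinal jl) => /= -> ->.
  by have /forallP/(_ (Ordinal jl))/implyP := tI (Ordinal il); apply.
apply/forallP => i; apply/forallP => j; apply/implyP => ij.
by rewrite -!nthE; apply: srt; rewrite ?inE ?sizeE.
Qed.

Lemma incr_inj l m (t : {ffun 'I_l -> 'I_m}) : incr t -> injective t.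
Proof.
move=> /forallP tI i j tij; apply: val_inj; case: (ltngtP i j) => // ij.
  by have /forallP/(_ j)/implyP/(_ ij) := tI i; rewrite tij ltnn.
by have /forallP/(_ i)/implyP/(_ ij) := tI j; rewrite tij ltnn.
Qed.

Lemma elem_sym_sets l m (x : 'I_m -> R) :
  elem_sym l x = \sum_(A : {set 'I_m} | #|A| == l) \prod_(i in A) x i.
Proof.
pose h (t : {ffun 'I_l -> 'I_m}) : {set 'I_m} := [set t j | j : 'I_l].
pose D := [set t : {ffun 'I_l -> 'I_m} | incr t].
have h_inj : {in D &, injective h}.
  move=> s t; rewrite !inE !incr_sorted => sI tI st.
  suff /(inj_map val_inj) E : [seq val i | i <- codom s] = [seq val i | i <- codom t].
    apply/ffunP => i; have /= := congr1 (fun u => nth (s i) u (enum_rank i)) E.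
    by rewrite !nth_codom enum_rankK.
  apply: (irr_sorted_eq ltn_trans ltnn sI tI) => y.
  have mem_h (u : {ffun 'I_l -> 'I_m}) i : (i \in codom u) = (i \in h u).
    by apply/codomP/imsetP => [[j ->]|[j _ ->]]; exists j.
  by apply/mapP/mapP => -[i iu ->]; exists i => //; move: iu; rewrite !mem_h st.
transitivity (\sum_(A in [set h t | t in D]) \prod_(i in A) x i); last first.
  apply: eq_bigl => A; apply/imsetP/eqP => [[t]|cA].
    rewrite inE => /incr_inj tI ->.
    by rewrite card_imset // card_ord.
  case: l @h @D {h_inj} cA => [|l] h D cA.
    have no0 : 'I_0 -> False by case.
    exists [ffun i : 'I_0 => False_rect 'I_m (no0 i)].
      by rewrite inE; apply/forallP => -[].
    rewrite (cards0_eq cA); apply/setP => i; rewrite inE; apply/esym/imsetP.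
    by case=> -[].
  have sA : size (enum A) = l.+1 by rewrite -cardE.
  have [x0 _] : exists x0, x0 \in A by apply/card_gt0P; rewrite cA.
  pose t := [ffun j : 'I_l.+1 => nth x0 (enum A) j].
  have tE : codom t = enum A.
    apply: (@eq_from_nth _ x0) => [|i]; rewrite size_codom card_ord ?sA // => il.
    rewrite -[i]/(val (Ordinal il)) /codom /image_mem (nth_map ord0) ?size_enum_ord //.
    by rewrite nth_ord_enum ffunE.
  exists t.
    rewrite inE incr_sorted tE -[enum _](eq_filter (mem_enum _)).
    rewrite -(eq_filter (mem_map val_inj _)) -filter_map.
    by rewrite (sorted_filter ltn_trans) // unlock val_ord_enum iota_ltn_sorted.
  apply/setP => i; rewrite -mem_enum -tE.
  by apply/codomP/imsetP => [[j ->]|[j _ ->]]; exists j.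
rewrite big_imset //= /elem_sym [RHS](eq_bigl (@incr l m)) => [|t]; last by rewrite inE.
apply: eq_bigr => t /incr_inj tI; rewrite big_imset /=; first exact: eq_bigl.
by move=> i j _ _; apply: tI.
Qed.

Lemma elem_sym_perm l m (x : 'I_m -> R) (tau : 'S_m) :
  elem_sym l (x \o tau) = elem_sym l x.
Proof.
rewrite !elem_sym_sets [RHS](reindex_inj (imset_inj (@perm_inj _ tau))) /=.
apply: eq_big => A; first by rewrite card_imset //; apply: perm_inj.
by move=> _; rewrite big_imset //=; apply: in2W; apply: perm_inj.
Qed.

End ElementarySymmetric.

Definition is_measure (R : realType) (k : nat) (mu : {set 'I_k} -> R) : Prop :=
  forall a b : {set 'I_k}, [disjoint a & b] -> mu (a :|: b) = mu a + mu b.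

Section SymE.
Variables (R : realType) (k m l : nat) (mu : {set 'I_k} -> R).

Definition tens_e (u : tensor R k m) : R :=
  \sum_(a : words k m) u a * elem_sym l (fun i => mu (a i)).

Fact tens_e_is_linear (c : R) (u v : tensor R k m) :
  tens_e (c *: u + v) = c * tens_e u + tens_e v.
Proof.
rewrite /tens_e mulr_sumr -big_split; apply: eq_bigr => a _ /=.
by rewrite !ffunE mulrDl mulrA.
Qed.

Lemma tens_e_act tau u : tens_e (tact tau u) = tens_e u.
Proof.
have act_inj : injective (fun a : words k m => [ffun i => a (tau i)] : words k m).
  move=> a b /ffunP E; apply/ffunP => i.
  by have := E (tau^-1%g i); rewrite !ffunE permKV.
rewrite [RHS]/tens_e (reindex_inj act_inj); apply: eq_bigr => a _ /=.
rewrite ffunE -(elem_sym_perm l _ tau); congr (_ * _).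
by apply: eq_bigr => t _; apply: eq_bigr => j _; rewrite /= ffunE.
Qed.

(* Independent of the representative chosen here, by [sym_e_cls] below. *)
Definition sym_e (x : sym R k m) : R := tens_e (repr x).

Lemma sym_e_cls u : sym_e (cls u) = tens_e u.
Proof.
apply: (cls_lift _ tens_e_act); last by rewrite cls_repr.
by move=> x y; rewrite -[x - y]addrC -scaleN1r tens_e_is_linear mulN1r addrC.
Qed.

Fact sym_e_is_linear : linear (sym_e : sym R k m -> R^o).
Proof.
move=> c x y; rewrite -[x]cls_repr -[y]cls_repr -linearP !sym_e_cls.
exact: tens_e_is_linear.
Qed.
HB.instance Definition _ :=
  GRing.isLinear.Build R (sym R k m) R^o *:%R sym_e sym_e_is_linear.

Lemma sym_e_class (a : 'I_m -> {set 'I_k}) :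
  sym_e (sym_class R a) = elem_sym l (fun i => mu (a i)).
Proof.
have -> : sym_class R a = cls (basis R ([ffun i => a i] : words k m)).
  rewrite -pure_basis; congr cls; apply/ffunP => b; rewrite !ffunE.
  by apply: eq_bigr => i _; rewrite !ffunE.
rewrite sym_e_cls /tens_e (bigD1 [ffun i => a i]) //= ffunE eqxx mul1r.
rewrite big1 ?addr0 => [|b ba]; last by rewrite ffunE (negbTE ba) mul0r.
by apply: eq_bigr => t _; apply: eq_bigr => j _; rewrite /= ffunE.
Qed.

End SymE.

(* Main.v *)
Require Import Defs.
From mathcomp Require Import all_boot all_order all_fingroup all_algebra.
From mathcomp Require Import reals.
Import GRing.Theory Num.Theory.
Local Open Scope ring_scope.

(** The union of n classes is the average, over all (n-1)-tuples of
    permutations, of the classes of the componentwise unions; this follows by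
    induction, absorbing the classes one at a time into the first.  Applying the
    linear map [e_l], each summand becomes an elementary symmetric function of
    measures of unions; inclusion-exclusion expands every such measure, and
    distributing the product over j of these sums yields the sum over f. *)

Section FfunCons.
Context {T : finType} {n : nat}.

Definition ffun_cons (x : T) (s : {ffun 'I_n -> T}) : {ffun 'I_n.+1 -> T} :=
  [ffun i => if unlift ord0 i is Some j then s j else x].

Lemma ffun_cons0 x s : ffun_cons x s ord0 = x.
Proof. by rewrite ffunE unlift_none. Qed.

Lemma ffun_cons_lift x s j : ffun_cons x s (lift ord0 j) = s j.
Proof. by rewrite ffunE liftK. Qed.

(** Splits off the permutation attached to the first class, both in the induction and to impose that
    it is the identity. *)
Lemma sum_ffun_cons (V : nmodType) (F : {ffun 'I_n.+1 -> T} -> V) :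
  \sum_s F s = \sum_x \sum_s F (ffun_cons x s).
Proof.
rewrite pair_bigA /= (reindex (fun p => ffun_cons p.1 p.2)) //=.
exists (fun s => (s ord0, [ffun j => s (lift ord0 j)])) => [[x s]|s] _.
  congr pair; first by rewrite /= ffun_cons0.
  by apply/ffunP => j; rewrite !ffunE liftK.
by apply/ffunP => i; rewrite !ffunE; case: unliftP => [j|] -> //=; rewrite ffunE.
Qed.

End FfunCons.

Section Measure.
Variables (R : realType) (k : nat) (mu : {set 'I_k} -> R).
Hypothesis mu_measure : is_measure mu.

Lemma measure_set0 : mu set0 = 0.
Proof.
have /mu_measure : [disjoint set0 & set0 : {set 'I_k}] by rewrite -setI_eq0 setI0.
by rewrite setU0 => /(canLR (addrK _)); rewrite subrr.
Qed.

(** By additivity, removing one point at a time. It reduces inclusion-exclusion to an identity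
    between indicators at a single point. *)
Lemma measure_sum (A : {set 'I_k}) : mu A = \sum_(x in A) mu [set x].
Proof.
have [c] := ubnP #|A|; elim: c A => // c IH A.
have [->|[x xA]] := set_0Vmem A; first by rewrite big_set0 measure_set0.
rewrite (cardsD1 x) xA => cA.
rewrite (big_setD1 x) //= -IH // -mu_measure ?setD1K //.
by rewrite disjoints1 !inE eqxx.
Qed.

Lemma measure_bigcup (n : nat) (A : 'I_n -> {set 'I_k}) :
  mu (\bigcup_i A i) =
  \sum_(S : {set 'I_n} | S != set0)
    (-1) ^+ (#|S| + 1) * mu (\bigcap_(i in S) A i).
Proof.
have ind (B : {set 'I_k}) : mu B = \sum_x (x \in B)%:R * mu [set x].
  rewrite measure_sum big_mkcond; apply: eq_bigr => x _.
  by case: (x \in B); rewrite ?mul1r ?mul0r.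
rewrite ind; under [RHS]eq_bigr do rewrite ind mulr_sumr.
rewrite exchange_big /=; apply: eq_bigr => x _.
under [RHS]eq_bigr do rewrite mulrA.
rewrite -mulr_suml; congr (_ * _).
(* Expand [\prod_i (1 - [x \in A i])], the indicator of the complement. *)
have : \prod_i (- (x \in A i)%:R + 1 : R) = \sum_(S : {set 'I_n})
    (-1) ^+ #|S| * (x \in \bigcap_(i in S) A i)%:R.
  rewrite bigA_distr; apply: eq_bigr => S _.
  rewrite -big_mkcond /=; under eq_bigr do rewrite -mulN1r.
  rewrite big_split /= prodr_const; congr (_ * _).
  rewrite -natr_prod; congr _%:R; apply/esym.
  have [/bigcapP xS|/bigcapP xS] := boolP (x \in _).
    by rewrite big1 // => i /xS ->.
  have [i /andP[iS xi]|xA] := pickP (fun i => (i \in S) && (x \notin A i)).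
    by rewrite (bigD1 i) //= (negbTE xi).
  by case: xS => i iS; have := xA i; rewrite iS => /negbFE.
(* The term of [set0] is 1, the empty intersection being the whole set. Moving it across and
   negating leaves 1 minus the product. *)
rewrite (bigD1 set0) //= cards0 expr0 mul1r big_set0 inE.
move/eqP; rewrite addrC -subr_eq => /eqP/(congr1 -%R); rewrite -sumrN.
have signS (c : nat) (b : R) : - ((-1) ^+ c * b) = (-1) ^+ (c + 1) * b.
  by rewrite addn1 exprS mulN1r mulNr.
rewrite (eq_bigr _ (fun S _ => signS _ _)) => <-; rewrite opprB.
(* The product has a factor [-1 + 1] if [x] lies in some [A i]; otherwise all its factors are 1. *)
have [/bigcupP[i _ xi]|xA] := boolP (x \in _).
  by rewrite (bigD1 i) //= xi addNr mul0r subr0.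
rewrite big1 ?subrr // => i _.
have [xi|_] := boolP (x \in A i); last by rewrite oppr0 add0r.
by case/bigcupP: xA; exists i.
Qed.

Lemma elem_sym_bigcup (l m n : nat) (A : 'I_m -> 'I_n -> {set 'I_k}) :
  elem_sym l (fun t => mu (\bigcup_i A t i)) =
  \sum_(t : {ffun 'I_l -> 'I_m} | incr t)
  \sum_(f : {ffun 'I_l -> {set 'I_n}} | [forall j, f j != set0])
    \prod_(j < l) ((-1) ^+ (#|f j| + 1) * mu (\bigcap_(i in f j) A (t j) i)).
Proof.
apply: eq_bigr => t _; under eq_bigr do rewrite measure_bigcup.
by rewrite bigA_distr_big.
Qed.

End Measure.

Section SymUnion.
Variables (R : realType) (k m : nat).

Lemma eq_sym_class (a b : 'I_m -> {set 'I_k}) :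
  a =1 b -> sym_class R a = sym_class R b.
Proof.
move=> ab; congr cls; apply/ffunP => w; rewrite !ffunE.
by apply: eq_bigr => i _; rewrite ab.
Qed.

Lemma sym_union_class (a b : 'I_m -> {set 'I_k}) :
  sym_union (sym_class R a) (sym_class R b) =
  (m`!%:R)^-1 *: \sum_(s : 'S_m) sym_class R (fun t => a t :|: b (s t)).
Proof.
(* [tact] permutes factors by the inverse, so summing over inverses yields [b (s t)]. *)
rewrite sym_unionE; congr (_ *: _); rewrite (reindex_inj invg_inj) /=.
apply: eq_bigr => s _; rewrite tact_pure tunion_pure invgK; congr cls.
apply/ffunP => w; rewrite !ffunE; apply: eq_bigr => i _.
by rewrite /punion bilinear_ext_basis.
Qed.

(** The accumulator [b] makes the induction work: after absorbing [a ord0] along a permutation [x],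
    the family [b t :|: a ord0 (x t)] is the new accumulator. *)
Lemma sym_union_bigcup (n : nat) (b : 'I_m -> {set 'I_k})
    (a : 'I_n -> 'I_m -> {set 'I_k}) :
  sym_union (sym_class R b)
    (\big[@sym_union R k m / sym_unit]_(i < n) sym_class R (a i)) =
  (m`!%:R ^+ n)^-1 *: \sum_(s : {ffun 'I_n -> 'S_m})
    sym_class R (fun t => b t :|: \bigcup_i a i (s i t)).
Proof.
elim: n b a => [|n IH] b a.
  rewrite big_ord0 sym_unionC sym_union_unit expr0 invr1 scale1r.
  rewrite (eq_bigr (fun=> sym_class R b)) => [|s _]; last first.
    by apply: eq_sym_class => t; rewrite big_ord0 setU0.
  (* There is exactly one empty tuple of permutations. *)
  by rewrite sumr_const card_ffun card_ord expn0.
(* Commuting puts the average in the second argument, where linearity of [sym_union] is declared. *)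
rewrite big_ord_recl sym_unionA sym_union_class sym_unionC linearZ linear_sum /=.
under eq_bigr do rewrite sym_unionC IH.
rewrite -scaler_sumr scalerA -invfM -exprS sum_ffun_cons; congr (_ *: _).
apply: eq_bigr => x _; apply: eq_bigr => s _; apply: eq_sym_class => t.
rewrite big_ord_recl ffun_cons0 setUA; congr (_ :|: _).
by apply: eq_bigr => i _; rewrite ffun_cons_lift.
Qed.

Lemma sym_bigunion_class (n : nat) (a : 'I_n.+1 -> 'I_m -> {set 'I_k}) :
  \big[@sym_union R k m / sym_unit]_(i < n.+1) sym_class R (a i) =
  (m`!%:R ^+ n)^-1 *: \sum_(s : {ffun 'I_n.+1 -> 'S_m} | s ord0 == 1%g)
    sym_class R (fun t => \bigcup_i a i (s i t)).
Proof.
rewrite big_ord_recl sym_union_bigcup; congr (_ *: _).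
(* The first class serves as accumulator and is never permuted, so only tuples with head 1
   contribute. *)
rewrite [RHS]big_mkcond sum_ffun_cons (bigD1 1%g) //= [X in _ + X]big1 ?addr0.
  apply: eq_bigr => s _; rewrite ffun_cons0 eqxx; apply: eq_sym_class => t.
  rewrite big_ord_recl ffun_cons0 perm1; congr (_ :|: _).
  by apply: eq_bigr => i _; rewrite ffun_cons_lift.
by move=> x /negbTE x1; rewrite big1 // => s _; rewrite ffun_cons0 x1.
Qed.

End SymUnion.

Theorem theorem4p7 (R : realType) (k m n l : nat)
  (hk : (1 <= k)%N) (hm : (1 <= m)%N) (hn : (1 <= n)%N)
  (hl : (1 <= l <= m)%N)
  (mu : {set 'I_k} -> R) (hmu : is_measure mu)
  (a : 'I_n -> 'I_m -> {set 'I_k}) :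
  sym_e l mu (\big[@sym_union R k m / sym_unit]_(i < n) sym_class R (a i))
  = ((m`!)%:R ^+ (n - 1))^-1 *
    \sum_(sigma : {ffun 'I_n -> 'S_m} |
            [forall i : 'I_n, (i == 0%N :> nat) ==> (sigma i == 1%g)])
    \sum_(t : {ffun 'I_l -> 'I_m} | incr t)
    \sum_(f : {ffun 'I_l -> {set 'I_n}} | [forall j, f j != set0])
      \prod_(j < l) ((-1) ^+ (#|f j| + 1) *
        mu (\bigcap_(i in f j) a i (sigma i (t j)))).
Proof.
case: n hn a => // n _ a; rewrite subn1 sym_bigunion_class linearZ linear_sum /=.
congr (_ * _); apply: eq_big => [s|s _].
  (* [ord0] is the only index of value 0, so both conditions say that the first permutation is the
     identity. *)
  apply/idP/forallP => [s1 i|/(_ ord0)//].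
  by apply/implyP => i0; rewrite (_ : i = ord0) //; apply/val_inj/eqP.
by rewrite sym_e_class elem_sym_bigcup.
Qed.
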